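(* Let $\mathbb{F}$ be a field and let $\mathbf{Nil}_2(\mathbf{Com})$ be the variety of two-step nilpotent commutative algebras over $\mathbb{F}$. (1) Let $B$ and $X$ be objects of $\mathbf{Nil}_2(\mathbf{Com})$. The isomorphism classes of split extensions of $B$ by $X$ in $\mathbf{Nil}_2(\mathbf{Com})$ are in bijection with the algebra homomorphisms $$B\to[X]_2\colon b\mapsto b\ast-$$ satisfying $$b\ast(b'\ast x)=0,\qquad\forall b,b'\in B,\ \forall x\in X.\qquad(\dagger)$$ (2) The variety $\mathbf{Nil}_2(\mathbf{Com})$ is weakly action representable. For each object $X$, a weak representation of the functor $\mathrm{SplExt}(-,X)=\mathrm{SplExt}_{\mathbf{Nil}_2(\mathbf{Com})}(-,X)$ is given by $$\tau\colon\mathrm{SplExt}(-,X)\rightarrowtail\mathrm{Hom}_{\mathbf{Nil}_2(\mathbf{Com})}(-,[X]_2),$$ where $\tau_B$ is the injection which sends any split extension of $B$ by $X$ to the corresponding homomorphism $B\to[X]_2$, $b\mapsto b\ast-$. (3) A homomorphism $B\to[X]_2$, $b\mapsto b\ast -$, is an acting morphism if and only if it satisfies $(\dagger)$.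
   Context: Algebras are vector spaces over $\mathbb{F}$ with a bilinear multiplication; $\mathbf{Nil}_2(\mathbf{Com})$ is the class of algebras satisfying $xy=yx$ and $x(yz)=(xy)z=0$, with multiplicative linear maps as morphisms. For $X$ in $\mathbf{Nil}_2(\mathbf{Com})$, $[X]_2=\{f\in\mathrm{End}(X)\mid f(xy)=f(x)y=0,\ \forall x,y\in X\}$, where $\mathrm{End}(X)$ is the space of linear endomorphisms; it is regarded as an abelian algebra, i.e. with zero multiplication. A split extension of $B$ by $X$ in a category $\mathcal{C}$ of algebras is a diagram $X\xrightarrow{i}A\rightleftarrows B$ with $\pi\colon A\to B$, $s\colon B\to A$, $\pi s=1_B$, $i$ a kernel of $\pi$. It determines a derived action: $b\ast x=s(b)i(x)$ and $x\ast b=i(x)s(b)$, viewed as elements of $X$; the homomorphism corresponding to the split extension is $b\mapsto b\ast-$. $\mathrm{SplExt}(-,X)\colon\mathcal{C}^{\mathrm{op}}\to\mathbf{Set}$ sends $B$ to the set of isomorphism classes (isomorphisms fixing $X$ and $B$) of split extensions of $B$ by $X$, and $f\colon B'\to B$ to pullback along $f$. $\mathcal{C}$ is weakly action representable if for every $X$ there are an object $T$ of $\mathcal{C}$ and a natural transformation with injective components $\tau\colon\mathrm{SplExt}(-,X)\rightarrowtail\mathrm{Hom}_{\mathcal{C}}(-,T)$; then $(T,\tau)$ is a weak representation of $\mathrm{SplExt}(-,X)$, and a morphism $B\to T$ in the image of $\tau_B$ is called an acting morphism. *)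

(* Defs.v *)
From HB Require Import structures.
From mathcomp Require Import all_boot all_algebra.
From mathcomp Require Import boolp classical_sets functions.

Set Implicit Arguments.
Unset Strict Implicit.
Unset Printing Implicit Defensive.

Import GRing.Theory.
Local Open Scope ring_scope.

(* Not assumed associative, commutative or unital. *)
HB.mixin Record Lmodule_hasMul (F : fieldType) A of GRing.Lmodule F A := {
  amul : A -> A -> A;
  amul_linearl : forall y : A, linear (fun x => amul x y);
  amul_linearr : forall x : A, linear (fun y => amul x y)
}.

#[short(type="nalgType")]
HB.structure Definition NAlgebra (F : fieldType) :=
  {A of GRing.Lmodule F A & Lmodule_hasMul F A}.

Reserved Notation "x ** y" (at level 40, left associativity).
Notation "x ** y" := (amul x y) : ring_scope.

HB.mixin Record NAlgebra_isNil2Com (F : fieldType) A of NAlgebra F A := {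
  amulC : forall x y : A, x ** y = y ** x;
  amulr_nil : forall x y z : A, x ** (y ** z) = 0;
  amull_nil : forall x y z : A, (x ** y) ** z = 0
}.

#[short(type="nil2comType")]
HB.structure Definition Nil2Com (F : fieldType) :=
  {A of NAlgebra F A & NAlgebra_isNil2Com F A}.

Section MulTheory.
Variables (F : fieldType) (A : nalgType F).
Implicit Types x y z : A.

Lemma amulDl x y z : (x + y) ** z = x ** z + y ** z.
Proof. by have := amul_linearl z 1 x y; rewrite !scale1r. Qed.

Lemma amulDr x y z : x ** (y + z) = x ** y + x ** z.
Proof. by have := amul_linearr x 1 y z; rewrite !scale1r. Qed.

Lemma amul0l x : 0 ** x = 0.
Proof. by apply: (addrI (0 ** x)); rewrite -amulDl !addr0. Qed.

Lemma amul0r x : x ** 0 = 0.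
Proof. by apply: (addrI (x ** 0)); rewrite -amulDr !addr0. Qed.
End MulTheory.

Record ahom (F : fieldType) (A B : nil2comType F) := AHom {
  hom_fun :> A -> B;
  hom_linear : linear hom_fun;
  hom_mul : {morph hom_fun : x y / x ** y}
}.

HB.instance Definition _ (F : fieldType) (A B : nil2comType F) (f : ahom A B) :=
  GRing.isLinear.Build F A B *:%R f (hom_linear f).

Lemma hom_ext (F : fieldType) (A B : nil2comType F) (f g : ahom A B) :
  f =1 g -> f = g.
Proof.
case: f g => [f lf mf] [g lg mg] /= /funext efg; subst g.
by congr AHom; exact: Prop_irrelevance.
Qed.

Section Category.
Variable F : fieldType.
Implicit Types A B C : nil2comType F.

Lemma hom_id_linear A : linear (@idfun A). Proof. by []. Qed.
Lemma hom_id_mul A : {morph @idfun A : x y / x ** y}. Proof. by []. Qed.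
Definition hom_id A : ahom A A := AHom (@hom_id_linear A) (@hom_id_mul A).

Lemma hom_comp_linear A B C (g : ahom B C) (f : ahom A B) : linear (g \o f).
Proof. by move=> a x y /=; rewrite !linearP. Qed.
Lemma hom_comp_mul A B C (g : ahom B C) (f : ahom A B) :
  {morph g \o f : x y / x ** y}.
Proof. by move=> x y /=; rewrite !hom_mul. Qed.
Definition hom_comp A B C (g : ahom B C) (f : ahom A B) : ahom A C :=
  AHom (hom_comp_linear g f) (hom_comp_mul g f).

Lemma hom_zero_linear A B : linear (fun _ : A => 0 : B).
Proof. by move=> a x y /=; rewrite scaler0 addr0. Qed.
Lemma hom_zero_mul A B : {morph (fun _ : A => 0 : B) : x y / x ** y}.
Proof. by move=> x y; rewrite amul0l. Qed.
Definition hom_zero A B : ahom A B :=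
  AHom (@hom_zero_linear A B) (@hom_zero_mul A B).

Definition is_kernel X A B (i : ahom X A) (p : ahom A B) : Prop :=
  hom_comp p i = hom_zero X B /\
  forall C (h : ahom C A), hom_comp p h = hom_zero C B ->
    exists! u : ahom C X, hom_comp i u = h.
End Category.

(* Binary products and equalizers; both are needed to build pullbacks. *)
Section Product.
Variables (F : fieldType) (A B : nil2comType F).

Definition prod_amul (u v : A * B) : A * B := (u.1 ** v.1, u.2 ** v.2).

Lemma prod_amul_linearl v : linear (fun u => prod_amul u v).
Proof.
by move=> a [x1 x2] [y1 y2]; rewrite /prod_amul /= !amul_linearl.
Qed.
Lemma prod_amul_linearr u : linear (fun v => prod_amul u v).
Proof.
by move=> a [x1 x2] [y1 y2]; rewrite /prod_amul /= !amul_linearr.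
Qed.
HB.instance Definition _ :=
  Lmodule_hasMul.Build F (A * B)%type prod_amul_linearl prod_amul_linearr.

Lemma prod_amulC (u v : A * B) : u ** v = v ** u.
Proof. by congr pair; exact: amulC. Qed.
Lemma prod_amulr_nil (u v w : A * B) : u ** (v ** w) = 0.
Proof. by congr pair; exact: amulr_nil. Qed.
Lemma prod_amull_nil (u v w : A * B) : (u ** v) ** w = 0.
Proof. by congr pair; exact: amull_nil. Qed.
HB.instance Definition _ := NAlgebra_isNil2Com.Build F (A * B)%type
  prod_amulC prod_amulr_nil prod_amull_nil.

Lemma fst_linear : linear (fst : A * B -> A). Proof. by []. Qed.
Lemma fst_amul : {morph (fst : A * B -> A) : x y / x ** y}. Proof. by []. Qed.
Definition hom_fst : ahom (A * B)%type A := AHom fst_linear fst_amul.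

Lemma snd_linear : linear (snd : A * B -> B). Proof. by []. Qed.
Lemma snd_amul : {morph (snd : A * B -> B) : x y / x ** y}. Proof. by []. Qed.
Definition hom_snd : ahom (A * B)%type B := AHom snd_linear snd_amul.

Lemma pair_linear C (f : ahom C A) (g : ahom C B) : linear (fun c => (f c, g c)).
Proof. by move=> a x y; rewrite !linearP. Qed.
Lemma pair_amul C (f : ahom C A) (g : ahom C B) :
  {morph (fun c => (f c, g c)) : x y / x ** y}.
Proof. by move=> x y; rewrite !hom_mul. Qed.
Definition hom_pair C (f : ahom C A) (g : ahom C B) : ahom C (A * B)%type :=
  AHom (pair_linear f g) (pair_amul f g).
End Product.

Section Equalizer.
Variables (F : fieldType) (A B : nil2comType F) (f g : ahom A B).

Definition eqz_pred : {pred A} := [pred x | f x == g x].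

Lemma eqz_submod_closed : submod_closed eqz_pred.
Proof.
split=> [|a x y]; rewrite !inE ?linear0 // => /eqP fgx /eqP fgy.
by rewrite !hom_linear fgx fgy.
Qed.
HB.instance Definition _ := GRing.isSubmodClosed.Build F A eqz_pred eqz_submod_closed.

Record eqz := Eqz { eqz_val : A; eqz_valP : eqz_val \in eqz_pred }.
HB.instance Definition _ := [isSub for eqz_val].
HB.instance Definition _ := [Choice of eqz by <:].
HB.instance Definition _ := [SubChoice_isSubLmodule of eqz by <:].

Lemma eqz_amul_closed (x y : eqz) : eqz_val x ** eqz_val y \in eqz_pred.
Proof.
have /eqP fx := eqz_valP x; have /eqP fy := eqz_valP y.
by rewrite inE !hom_mul fx fy.
Qed.
Definition eqz_amul (x y : eqz) : eqz := Eqz (eqz_amul_closed x y).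

Lemma eqz_amul_linearl y : linear (fun x => eqz_amul x y).
Proof. by move=> a u v; apply: val_inj; exact: amul_linearl. Qed.
Lemma eqz_amul_linearr x : linear (fun y => eqz_amul x y).
Proof. by move=> a u v; apply: val_inj; exact: amul_linearr. Qed.
HB.instance Definition _ :=
  Lmodule_hasMul.Build F eqz eqz_amul_linearl eqz_amul_linearr.

Lemma eqz_amulC (u v : eqz) : u ** v = v ** u.
Proof. by apply: val_inj; exact: amulC. Qed.
Lemma eqz_amulr_nil (u v w : eqz) : u ** (v ** w) = 0.
Proof. by apply: val_inj; exact: amulr_nil. Qed.
Lemma eqz_amull_nil (u v w : eqz) : (u ** v) ** w = 0.
Proof. by apply: val_inj; exact: amull_nil. Qed.
HB.instance Definition _ := NAlgebra_isNil2Com.Build F eqz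
  eqz_amulC eqz_amulr_nil eqz_amull_nil.

Lemma eqz_val_linear : linear eqz_val. Proof. by []. Qed.
Lemma eqz_val_amul : {morph eqz_val : x y / x ** y}. Proof. by []. Qed.
Definition eqz_incl : ahom eqz A := AHom eqz_val_linear eqz_val_amul.

Lemma eqz_lift_closed C (h : ahom C A) (fgh : hom_comp f h = hom_comp g h) c :
  h c \in eqz_pred.
Proof. by have /(congr1 (@^~ c \o @hom_fun _ _ _)) /= /eqP := fgh. Qed.
Definition eqz_lift_fun C (h : ahom C A) (fgh : hom_comp f h = hom_comp g h) c :=
  Eqz (eqz_lift_closed fgh c).
Lemma eqz_lift_linear C (h : ahom C A) (fgh : hom_comp f h = hom_comp g h) :
  linear (eqz_lift_fun fgh).
Proof. by move=> a x y; apply: val_inj; exact: hom_linear. Qed.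
Lemma eqz_lift_amul C (h : ahom C A) (fgh : hom_comp f h = hom_comp g h) :
  {morph eqz_lift_fun fgh : x y / x ** y}.
Proof. by move=> x y; apply: val_inj; exact: hom_mul. Qed.
Definition eqz_lift C (h : ahom C A) (fgh : hom_comp f h = hom_comp g h) :
  ahom C eqz := AHom (eqz_lift_linear fgh) (eqz_lift_amul fgh).
End Equalizer.

Section KernelTheory.
Variables (F : fieldType) (X A B : nil2comType F).
Variables (i : ahom X A) (p : ahom A B).
Hypothesis kip : is_kernel i p.

Lemma kernel0 x : p (i x) = 0.
Proof. by have [/(congr1 (@^~ x \o @hom_fun _ _ _))] := kip. Qed.

Lemma kernel_inj : injective i.
Proof.
suff i0 x : i x = 0 -> x = 0.
  by move=> x y ixy; apply/subr0_eq/i0; rewrite linearB /= ixy subrr.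
move=> ix0; pose z := hom_zero X A.
have [_ /(_ (eqz i z) (hom_zero _ _))] := kip.
case=> [|u [_ uniq_u]]; first by apply: hom_ext => y /=; rewrite linear0.
have u0 : u = hom_zero _ _ by apply: uniq_u; apply: hom_ext => y /=; rewrite linear0.
have ui : u = eqz_incl i z.
  by apply: uniq_u; apply: hom_ext => y /=; have /eqP := eqz_valP y.
have xk : x \in eqz_pred i z by rewrite inE ix0.
by have /= := congr1 (fun h : ahom _ _ => h (Eqz xk)) (etrans (esym ui) u0).
Qed.

Lemma kernel_exact a : p a = 0 -> exists x, i x = a.
Proof.
move=> pa0; pose z := hom_zero A B.
have [_ /(_ (eqz p z) (eqz_incl p z))] := kip.
case=> [|u [iu _]]; first by apply: hom_ext => y /=; have /eqP := eqz_valP y.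
have ak : a \in eqz_pred p z by rewrite inE pa0.
by exists (u (Eqz ak)); have /= := congr1 (fun h : ahom _ _ => h (Eqz ak)) iu.
Qed.
End KernelTheory.

Section Bracket.
Variables (F : fieldType) (X : nil2comType F).

(* The algebra [X]_2, as a subspace of the pointwise vector space X -> X. *)
Definition br2_pred : {pred (X -> X)} := [pred f | `[<
  linear f /\ forall x y : X, f (x ** y) = 0 /\ f x ** y = 0 >]].

Lemma br2P (f : X -> X) :
  reflect (linear f /\ forall x y : X, f (x ** y) = 0 /\ f x ** y = 0)
    (f \in br2_pred).
Proof. exact: asboolP. Qed.

Lemma br2_submod_closed : submod_closed br2_pred.
Proof.
split=> [|a f g].
  apply/br2P; split=> [b x y|x y] /=.
    by rewrite /= scaler0 addr0.
  by split; rewrite ?amul0l.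
move=> /br2P[lf nf] /br2P[lg ng]; apply/br2P; split=> [b x y|x y].
  rewrite !fctE /= lf lg !scalerDr !scalerA (mulrC b a) -!addrA.
  by congr (_ + _); rewrite !addrA; congr (_ + _); rewrite addrC.
have [f1 f2] := nf x y; have [g1 g2] := ng x y.
split; rewrite !fctE /=; first by rewrite f1 g1 scaler0 addr0.
by rewrite amul_linearl f2 g2 scaler0 addr0.
Qed.
HB.instance Definition _ :=
  GRing.isSubmodClosed.Build F (X -> X) br2_pred br2_submod_closed.

Record br2 := Br2 { br2_fun :> X -> X; br2_funP : br2_fun \in br2_pred }.
HB.instance Definition _ := [isSub for br2_fun].
HB.instance Definition _ := [Choice of br2 by <:].
HB.instance Definition _ := [SubChoice_isSubLmodule of br2 by <:].

Definition br2_amul (f g : br2) : br2 := 0.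

Lemma br2_amul_linearl g : linear (fun f => br2_amul f g).
Proof. by move=> a u v; rewrite /br2_amul scaler0 addr0. Qed.
Lemma br2_amul_linearr f : linear (fun g => br2_amul f g).
Proof. by move=> a u v; rewrite /br2_amul scaler0 addr0. Qed.
HB.instance Definition _ :=
  Lmodule_hasMul.Build F br2 br2_amul_linearl br2_amul_linearr.

Lemma br2_amulC (f g : br2) : f ** g = g ** f. Proof. by []. Qed.
Lemma br2_amulr_nil (f g h : br2) : f ** (g ** h) = 0. Proof. by []. Qed.
Lemma br2_amull_nil (f g h : br2) : (f ** g) ** h = 0. Proof. by []. Qed.
HB.instance Definition _ := NAlgebra_isNil2Com.Build F br2
  br2_amulC br2_amulr_nil br2_amull_nil.
End Bracket.

Record split_ext (F : fieldType) (B X : nil2comType F) := SplitExt {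
  se_obj : nil2comType F;
  se_i : ahom X se_obj;
  se_p : ahom se_obj B;
  se_s : ahom B se_obj;
  se_ps : hom_comp se_p se_s = hom_id B;
  se_ker : is_kernel se_i se_p
}.

Definition se_iso (F : fieldType) (B X : nil2comType F)
    (E E' : split_ext B X) : Prop :=
  exists (phi : ahom (se_obj E) (se_obj E')) (psi : ahom (se_obj E') (se_obj E)),
    [/\ hom_comp psi phi = hom_id (se_obj E),
        hom_comp phi psi = hom_id (se_obj E'),
        hom_comp phi (se_i E) = se_i E',
        hom_comp (se_p E') phi = se_p E &
        hom_comp phi (se_s E) = se_s E'].

Section SplitExtIso.
Variables (F : fieldType) (B X : nil2comType F).
Implicit Types E : split_ext B X.

Lemma se_iso_refl E : se_iso E E.
Proof.
by exists (hom_id _), (hom_id _); split; apply: hom_ext.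
Qed.

Lemma hom_compE (A B' C : nil2comType F) (g : ahom B' C) (f : ahom A B') h :
  hom_comp g f = h -> forall x, g (f x) = h x.
Proof. by move=> <-. Qed.

Lemma se_iso_sym E E' : se_iso E E' -> se_iso E' E.
Proof.
case=> phi [psi [/hom_compE h1 /hom_compE h2 /hom_compE h3 /hom_compE h4 /hom_compE h5]].
exists psi, phi; split; apply: hom_ext => x /=.
- exact: h2.
- exact: h1.
- by rewrite -h3 h1.
- by rewrite -h4 h2.
- by rewrite -h5 h1.
Qed.

Lemma se_iso_trans E E' E'' : se_iso E E' -> se_iso E' E'' -> se_iso E E''.
Proof.
case=> phi [psi [/hom_compE h1 /hom_compE h2 /hom_compE h3 /hom_compE h4 /hom_compE h5]].
case=> phi' [psi' [/hom_compE k1 /hom_compE k2 /hom_compE k3 /hom_compE k4 /hom_compE k5]].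
exists (hom_comp phi' phi), (hom_comp psi psi'); split; apply: hom_ext => x /=.
- by rewrite k1 h1.
- by rewrite h2 k2.
- by rewrite h3 k3.
- by rewrite k4 h4.
- by rewrite h5 k5.
Qed.
End SplitExtIso.

(* An element of SplExt(B, X) is an equivalence class of se_iso. *)
Record SplExt (F : fieldType) (B X : nil2comType F) := SplExtClass {
  spl_class :> split_ext B X -> Prop;
  spl_classP : exists E, spl_class = se_iso E
}.

Section Classes.
Variables (F : fieldType) (B X : nil2comType F).

Lemma to_class_subproof (E : split_ext B X) : exists E', se_iso E = se_iso E'.
Proof. by exists E. Qed.
Definition to_class (E : split_ext B X) : SplExt B X :=
  SplExtClass (to_class_subproof E).

Definition class_repr (c : SplExt B X) : split_ext B X := projT1 (cid (spl_classP c)).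

Lemma class_reprK : cancel class_repr to_class.
Proof.
move=> [c cP]; rewrite /class_repr; case: cid => E /= eE; subst c.
by congr SplExtClass; exact: Prop_irrelevance.
Qed.

Lemma to_classP (E E' : split_ext B X) : to_class E = to_class E' <-> se_iso E E'.
Proof.
split=> [/(congr1 (@spl_class _ _ _)) /= EE'|EE']; first by rewrite EE'; exact: se_iso_refl.
suff eEE' : se_iso E = se_iso E'.
  rewrite /to_class; move: (to_class_subproof E) (to_class_subproof E').
  by rewrite eEE' => p q; congr SplExtClass; exact: Prop_irrelevance.
apply/funext => G; apply/propext; split=> [|E'G].
  by apply: se_iso_trans; exact: se_iso_sym.
exact: se_iso_trans E'G.
Qed.

Lemma to_classK (E : split_ext B X) : se_iso (class_repr (to_class E)) E.
Proof. by apply/to_classP; rewrite class_reprK. Qed.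
End Classes.

Section Pullback.
Variables (F : fieldType) (B B' X : nil2comType F) (f : ahom B' B).
Variable E : split_ext B X.
Notation A := (se_obj E).

Definition pb_obj : nil2comType F :=
  eqz (hom_comp (se_p E) (hom_fst A B')) (hom_comp f (hom_snd A B')).

Definition pb_fst : ahom pb_obj A := hom_comp (hom_fst A B') (eqz_incl _ _).
Definition pb_p : ahom pb_obj B' := hom_comp (hom_snd A B') (eqz_incl _ _).

Lemma pb_i_subproof :
  hom_comp (hom_comp (se_p E) (hom_fst A B')) (hom_pair (se_i E) (hom_zero X B'))
  = hom_comp (hom_comp f (hom_snd A B')) (hom_pair (se_i E) (hom_zero X B')).
Proof.
by apply: hom_ext => x /=; rewrite linear0 (kernel0 (se_ker E)).
Qed.
Definition pb_i : ahom X pb_obj := eqz_lift pb_i_subproof.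

Lemma pb_s_subproof :
  hom_comp (hom_comp (se_p E) (hom_fst A B'))
    (hom_pair (hom_comp (se_s E) f) (hom_id B'))
  = hom_comp (hom_comp f (hom_snd A B'))
    (hom_pair (hom_comp (se_s E) f) (hom_id B')).
Proof.
by apply: hom_ext => x /=; rewrite (hom_compE (se_ps E)).
Qed.
Definition pb_s : ahom B' pb_obj := eqz_lift pb_s_subproof.

Lemma pb_ps : hom_comp pb_p pb_s = hom_id B'.
Proof. exact: hom_ext. Qed.

Lemma pb_ker : is_kernel pb_i pb_p.
Proof.
split; first exact: hom_ext.
move=> C h /hom_compE ph0.
have [|u [/hom_compE iu uniq_u]] := (se_ker E).2 C (hom_comp pb_fst h).
  apply: hom_ext => c /=; have /eqP /= -> := eqz_valP (h c).
  by have /= -> := ph0 c; rewrite linear0.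
exists u; split=> [|v iv].
  apply: hom_ext => c; apply: val_inj => /=; have /= -> := iu c.
  by have /= := ph0 c; case: (eqz_val (h c)) => a b /= ->.
by apply: uniq_u; rewrite -iv; apply: hom_ext.
Qed.

Definition se_pullback : split_ext B' X := SplitExt pb_ps pb_ker.
End Pullback.

Lemma se_pullback_iso (F : fieldType) (B B' X : nil2comType F) (f : ahom B' B)
    (E E' : split_ext B X) :
  se_iso E E' -> se_iso (se_pullback f E) (se_pullback f E').
Proof.
have lift (G G' : split_ext B X) (phi : ahom (se_obj G) (se_obj G')) :
    hom_comp (se_p G') phi = se_p G ->
    exists q : ahom (pb_obj f G) (pb_obj f G'),
      forall x, eqz_val (q x) = (phi (eqz_val x).1, (eqz_val x).2).
  move=> /hom_compE pphi.
  pose h := hom_pair (hom_comp phi (pb_fst f G)) (pb_p f G).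
  have fgh : hom_comp (hom_comp (se_p G') (hom_fst _ B')) h
           = hom_comp (hom_comp f (hom_snd _ B')) h.
    by apply: hom_ext => x /=; rewrite pphi; have /eqP := eqz_valP x.
  by exists (eqz_lift fgh).
case=> phi [psi [/hom_compE h1 /hom_compE h2 /hom_compE h3 h4 /hom_compE h5]].
have [q qE] := lift _ _ _ h4.
have [|r rE] := lift _ _ psi.
  by apply: hom_ext => x /=; rewrite -(hom_compE h4) h2.
exists q, r; split; apply: hom_ext => x; try apply: val_inj => /=.
- by rewrite rE qE /= h1; case: (eqz_val x).
- by rewrite qE rE /= h2; case: (eqz_val x).
- by rewrite qE /= h3.
- by rewrite /= qE.
- by rewrite qE /= h5.
Qed.

(* SplExt(f, X). *)
Definition spl_map (F : fieldType) (B B' X : nil2comType F) (f : ahom B' B)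
    (c : SplExt B X) : SplExt B' X :=
  to_class (se_pullback f (class_repr c)).

Lemma spl_mapE (F : fieldType) (B B' X : nil2comType F) (f : ahom B' B)
    (E : split_ext B X) : spl_map f (to_class E) = to_class (se_pullback f E).
Proof. by apply/to_classP/se_pullback_iso; exact: to_classK. Qed.

Section DerivedAction.
Variables (F : fieldType) (B X : nil2comType F) (E : split_ext B X).

Lemma act_subproof (b : B) (x : X) : exists y, se_i E y = se_s E b ** se_i E x.
Proof.
apply: (kernel_exact (se_ker E)).
by rewrite hom_mul (kernel0 (se_ker E)) amul0r.
Qed.

(* b * x; by commutativity it coincides with x * b. *)
Definition act (b : B) (x : X) : X := projT1 (cid (act_subproof b x)).

Lemma actE b x : se_i E (act b x) = se_s E b ** se_i E x.
Proof. by rewrite /act; case: cid. Qed.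

Lemma act_br2 b : act b \in @br2_pred F X.
Proof.
apply/br2P; split=> [a x y|x y].
  apply: (kernel_inj (se_ker E)).
  by rewrite hom_linear !actE hom_linear amul_linearr.
split; apply: (kernel_inj (se_ker E)).
  by rewrite actE hom_mul amulr_nil linear0.
by rewrite hom_mul actE amull_nil linear0.
Qed.

Definition act_hom_fun (b : B) : br2 X := Br2 (act_br2 b).

Lemma act_hom_linear : linear act_hom_fun.
Proof.
move=> a b c; apply: val_inj; apply/funext => x.
apply: (kernel_inj (se_ker E)).
by rewrite /= !fctE hom_linear !actE hom_linear amul_linearl.
Qed.

Lemma act_hom_mul : {morph act_hom_fun : b c / b ** c}.
Proof.
move=> b c; apply: val_inj; apply/funext => x.
apply: (kernel_inj (se_ker E)).
by rewrite /= actE hom_mul amull_nil linear0.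
Qed.

Definition act_hom : ahom B (br2 X) := AHom act_hom_linear act_hom_mul.
End DerivedAction.

Lemma act_hom_iso (F : fieldType) (B X : nil2comType F) (E E' : split_ext B X) :
  se_iso E E' -> act_hom E = act_hom E'.
Proof.
case=> phi [psi [_ _ /hom_compE phii _ /hom_compE phis]].
apply: hom_ext => b; apply: val_inj; apply/funext => x.
apply: (kernel_inj (se_ker E')).
by rewrite /= actE -phii actE hom_mul phis phii.
Qed.

Definition tau (F : fieldType) (X B : nil2comType F) (c : SplExt B X) :
  ahom B (br2 X) := act_hom (class_repr c).

Lemma tauE (F : fieldType) (B X : nil2comType F) (E : split_ext B X) :
  tau (to_class E) = act_hom E.
Proof. exact/act_hom_iso/to_classK. Qed.

Section WeakRepresentation.
Variable F : fieldType.
Implicit Types X T B : nil2comType F.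

Definition weak_representation X T
    (t : forall B, SplExt B X -> ahom B T) : Prop :=
  (forall B B' (f : ahom B' B) (c : SplExt B X),
     t B' (spl_map f c) = hom_comp (t B c) f) /\
  (forall B, injective (t B)).

Definition weakly_action_representable : Prop :=
  forall X, exists T (t : forall B, SplExt B X -> ahom B T),
    weak_representation t.

Definition acting_morphism X T (t : forall B, SplExt B X -> ahom B T)
    B (h : ahom B T) : Prop :=
  exists c : SplExt B X, t B c = h.
End WeakRepresentation.

Definition dagger (F : fieldType) (B X : nil2comType F) (h : ahom B (br2 X)) :
    Prop :=
  forall (b b' : B) (x : X), h b (h b' x) = 0.

(* Main.v *)
(** A split extension of [B] by [X] has underlying space [s B + i X], and its
    multiplication is determined by [B], [X] and the action [b * x].  Two-step
    nilpotency forces (dagger): [b * (b' * x) = s b (s b' (i x)) = 0].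
    Conversely (dagger) is exactly what makes the semidirect product on
    [B * X] two-step nilpotent.  Hence [tau] is injective with image (dagger);
    its naturality is a computation in the pullback. *)

From HB Require Import structures.
Require Import Defs.
From mathcomp Require Import all_boot all_algebra.
From mathcomp Require Import boolp classical_sets functions.

Set Implicit Arguments.
Unset Strict Implicit.
Unset Printing Implicit Defensive.

Import GRing.Theory.
Local Open Scope ring_scope.
Local Open Scope classical_set_scope.

(** * The semidirect product attached to a homomorphism satisfying [dagger] *)

Section Semidirect.
Variables (F : fieldType) (B X : nil2comType F) (h : ahom B (br2 X)).

Lemma br2_linear (f : br2 X) : linear f.
Proof. by have /br2P[] := br2_funP f. Qed.

Lemma br2_amul_arg (f : br2 X) x y : f (x ** y) = 0.
Proof. by have /br2P[_ /(_ x y)[]] := br2_funP f. Qed.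

Lemma br2_amul_val (f : br2 X) x y : f x ** y = 0.
Proof. by have /br2P[_ /(_ x y)[]] := br2_funP f. Qed.

HB.instance Definition _ (f : br2 X) :=
  GRing.isLinear.Build F X X *:%R (br2_fun f) (br2_linear f).

Lemma hom_br2P a b c x : h (a *: b + c) x = a *: h b x + h c x.
Proof. by rewrite hom_linear. Qed.

(** [h] is multiplicative and the multiplication of [br2 X] is zero. *)
Lemma hom_br2_amul b c x : h (b ** c) x = 0.
Proof. by rewrite hom_mul. Qed.

Lemma hom_br2_0 x : h 0 x = 0.
Proof. by rewrite linear0. Qed.

(* The (dagger) proof is a parameter because the algebra structure attached to
   this alias of [B * X], which is not the product one, depends on it. *)
Definition semidirect (_ : dagger h) : Type := (B * X)%type.

Variable dh : dagger h.
Notation S := (semidirect dh).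

HB.instance Definition _ := GRing.Lmodule.copy S (B * X)%type.

Definition semidirect_amul (u v : S) : S :=
  (u.1 ** v.1, h u.1 v.2 + h v.1 u.2 + u.2 ** v.2).

Lemma semidirect_amulC_fun u v : semidirect_amul u v = semidirect_amul v u.
Proof.
by rewrite /semidirect_amul (amulC u.1) (amulC u.2) (addrC (h u.1 _)).
Qed.

Lemma semidirect_amul_linearr u : linear (semidirect_amul u).
Proof.
move=> a [b x] [c y]; congr pair => /=; first exact: amul_linearr.
rewrite linearP hom_br2P amul_linearr /= !scalerDr.
by rewrite [RHS]addrACA; congr (_ + _); rewrite addrACA.
Qed.

Lemma semidirect_amul_linearl v : linear (fun u => semidirect_amul u v).
Proof.
move=> a u w; rewrite !(semidirect_amulC_fun _ v).
exact: semidirect_amul_linearr.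
Qed.

HB.instance Definition _ := Lmodule_hasMul.Build F S
  semidirect_amul_linearl semidirect_amul_linearr.

Lemma semidirect_amulC (u v : S) : u ** v = v ** u.
Proof. exact: semidirect_amulC_fun. Qed.

(** In the [X]-component, [dh] kills the iterated actions, the zero product of [br2 X] kills the
    action of [v.1 ** w.1], and the two conditions defining [br2 X] kill the mixed terms; for the
    second one, [amulC] first brings the values of [h] to the left factor. *)
Lemma semidirect_amulr_nil (u v w : S) : u ** (v ** w) = 0.
Proof.
congr pair => /=; first exact: amulr_nil.
rewrite !linearD /= !dh br2_amul_arg hom_br2_amul !amulDr amulr_nil.
by rewrite !(amulC u.2) !br2_amul_val !addr0.
Qed.

Lemma semidirect_amull_nil (u v w : S) : (u ** v) ** w = 0.
Proof. by rewrite semidirect_amulC semidirect_amulr_nil. Qed.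

HB.instance Definition _ := NAlgebra_isNil2Com.Build F S
  semidirect_amulC semidirect_amulr_nil semidirect_amull_nil.

Definition sd_i_fun (x : X) : S := (0, x).
Lemma sd_i_linear : linear sd_i_fun.
Proof. by move=> a x y; congr pair; rewrite /= scaler0 addr0. Qed.
Lemma sd_i_amul : {morph sd_i_fun : x y / x ** y}.
Proof. by move=> x y; congr pair; rewrite /= ?amul0l // !hom_br2_0 !add0r. Qed.
Definition sd_i : ahom X S := AHom sd_i_linear sd_i_amul.

Definition sd_p_fun (u : S) : B := u.1.
Lemma sd_p_linear : linear sd_p_fun. Proof. by []. Qed.
Lemma sd_p_amul : {morph sd_p_fun : u v / u ** v}. Proof. by []. Qed.
Definition sd_p : ahom S B := AHom sd_p_linear sd_p_amul.

Definition sd_s_fun (b : B) : S := (b, 0).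
Lemma sd_s_linear : linear sd_s_fun.
Proof. by move=> a b c; congr pair; rewrite /= scaler0 addr0. Qed.
Lemma sd_s_amul : {morph sd_s_fun : b c / b ** c}.
Proof. by move=> b c; congr pair; rewrite /= !linear0 amul0l !addr0. Qed.
Definition sd_s : ahom B S := AHom sd_s_linear sd_s_amul.

Lemma sd_ps : hom_comp sd_p sd_s = hom_id B.
Proof. exact: hom_ext. Qed.

Lemma sd_ker : is_kernel sd_i sd_p.
Proof.
split=> [|C g /hom_compE g1]; first exact: hom_ext.
(* Since [sd_p] annihilates [g], the second component carries all of [g] and is the only candidate
   for the factorization through [sd_i]. *)
have gE c : g c = (0, (g c).2) by have /= <- := g1 c; case: (g c).
have g2_linear : linear (fun c => (g c).2).
  by move=> a x y; rewrite hom_linear.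
have g2_amul : {morph (fun c => (g c).2) : x y / x ** y}.
  by move=> x y; rewrite hom_mul gE (gE y) /= !hom_br2_0 !add0r.
exists (AHom g2_linear g2_amul); split=> [|v /hom_compE iv].
  by apply: hom_ext => c; rewrite /= [RHS]gE.
by apply: hom_ext => c; rewrite /= -iv.
Qed.

Definition semidirect_ext : split_ext B X := SplitExt sd_ps sd_ker.

(** In [S], the product of [(b, 0)] and [(0, x)] is [(0, h b x)]. This realizes every homomorphism
    satisfying [dagger] as a derived action. *)
Lemma act_hom_semidirect : act_hom semidirect_ext = h.
Proof.
apply: hom_ext => b; apply: val_inj; apply/funext => x.
apply: (kernel_inj (se_ker semidirect_ext)); apply: etrans (actE _ _ _) _.
by congr pair; rewrite /= ?amul0r // hom_br2_0 amul0l !addr0.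
Qed.

End Semidirect.

(** * The short five lemma for split extensions *)

Section SplitShortFive.
Variables (F : fieldType) (B X : nil2comType F).

(** The difference [a - se_s E (se_p E a)] is killed by [se_p E], hence comes from the kernel
    [X]. *)
Lemma split_ext_decomp (E : split_ext B X) a :
  exists x, a = se_s E (se_p E a) + se_i E x.
Proof.
have [|x ix] := kernel_exact (se_ker E) (a := a - se_s E (se_p E a)).
  by rewrite linearB /= (hom_compE (se_ps E)) subrr.
by exists x; rewrite ix addrC subrK.
Qed.

(** An element killed by [phi] is killed by [se_p E], so it comes from [X], where [se_i E'] is
    injective. Surjectivity lifts the two summands of [split_ext_decomp] separately. The inverse,
    chosen pointwise, is a homomorphism because [phi] is injective. *)
Lemma split_short_five (E E' : split_ext B X)
    (phi : ahom (se_obj E) (se_obj E')) :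
    hom_comp phi (se_i E) = se_i E' ->
    hom_comp (se_p E') phi = se_p E ->
    hom_comp phi (se_s E) = se_s E' ->
  se_iso E E'.
Proof.
move=> phii pphi phis.
have phi_inj : injective phi.
  suff phi0 a : phi a = 0 -> a = 0.
    by move=> a b ab; apply/subr0_eq/phi0; rewrite linearB /= ab subrr.
  move=> pa0; have [|x xa] := kernel_exact (se_ker E) (a := a).
    by rewrite -(hom_compE pphi) pa0 linear0.
  rewrite -xa in pa0 *; rewrite (hom_compE phii) in pa0.
  have -> : x = 0 by apply: (kernel_inj (se_ker E')); rewrite pa0 linear0.
  by rewrite linear0.
have phi_surj a' : exists a, phi a = a'.
  have [x ->] := split_ext_decomp a'.
  exists (se_s E (se_p E' a') + se_i E x).
  by rewrite linearD /= (hom_compE phii) (hom_compE phis).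
pose g a' := projT1 (cid (phi_surj a')).
have gK a' : phi (g a') = a' by rewrite /g; case: cid.
have g_linear : linear g.
  by move=> k x y; apply: phi_inj; rewrite hom_linear !gK.
have g_amul : {morph g : x y / x ** y}.
  by move=> x y; apply: phi_inj; rewrite hom_mul !gK.
exists phi, (AHom g_linear g_amul); split=> //; apply: hom_ext => x /=.
  by apply: phi_inj; rewrite gK.
exact: gK.
Qed.

End SplitShortFive.

(** * Image, injectivity and naturality of [tau] *)

Section Action.
Variables (F : fieldType) (B X : nil2comType F).
Implicit Type E : split_ext B X.

Lemma act_hom_dagger E : dagger (act_hom E).
Proof.
move=> b b' x; apply: (kernel_inj (se_ker E)).
by rewrite /= !actE amulr_nil linear0.
Qed.

(** Keeping [h] apart from [act_hom E] lets two extensions with equal actions be compared with one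
    and the same semidirect product. *)
Lemma semidirect_act_iso E (h : ahom B (br2 X)) (dh : dagger h) :
  act_hom E = h -> se_iso (semidirect_ext dh) E.
Proof.
move=> hE; subst h.
pose phi (u : semidirect dh) := se_s E u.1 + se_i E u.2.
have phi_linear : linear phi.
  by move=> a u v; rewrite /phi !hom_linear scalerDr addrACA.
have phi_amul : {morph phi : u v / u ** v}.
  move=> u v; rewrite /phi /= hom_mul !linearD /= !actE hom_mul.
  (* The four terms of the expanded product match those of [semidirect_amul]; commutativity is
     needed for the cross term pairing [v.1] with [u.2]. *)
  by rewrite !amulDl !amulDr (amulC (se_s E v.1)) !addrA.
pose phi_hom : ahom (se_obj (semidirect_ext dh)) (se_obj E) :=
  AHom phi_linear phi_amul.
apply: (@split_short_five _ _ _ _ _ phi_hom).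
- by apply: hom_ext => x; rewrite /= /phi linear0 add0r.
- apply: hom_ext => u; rewrite /= /phi linearD /= (hom_compE (se_ps E)).
  by rewrite (kernel0 (se_ker E)) addr0.
- by apply: hom_ext => b; rewrite /= /phi linear0 addr0.
Qed.

Lemma act_hom_inj E E' : act_hom E = act_hom E' -> se_iso E E'.
Proof.
move=> eqE; apply: (@se_iso_trans _ _ _ _ (semidirect_ext (@act_hom_dagger E'))).
  by apply: se_iso_sym; apply: semidirect_act_iso.
exact: semidirect_act_iso.
Qed.

(** In the pullback, [b] is lifted to [(se_s E (f b), b)] and [x] to [(se_i E x, 0)], so their
    product is [(se_i E (act E (f b) x), 0)]. *)
Lemma act_hom_pullback (B' : nil2comType F) (f : ahom B' B) E :
  act_hom (se_pullback f E) = hom_comp (act_hom E) f.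
Proof.
apply: hom_ext => b; apply: val_inj; apply/funext => x.
apply: (kernel_inj (se_ker (se_pullback f E))).
apply: etrans (actE _ _ _) _; apply: val_inj.
by congr pair; rewrite /= ?actE ?amul0r.
Qed.

Lemma tau_dagger (c : SplExt B X) : dagger (tau c).
Proof. exact: act_hom_dagger. Qed.

Lemma tau_inj : injective (@tau F X B).
Proof.
move=> c c' /act_hom_inj /to_classP.
by rewrite !class_reprK.
Qed.

Lemma tau_surj (h : ahom B (br2 X)) : dagger h -> exists c, tau c = h.
Proof.
by move=> dh; exists (to_class (semidirect_ext dh)); rewrite tauE act_hom_semidirect.
Qed.

End Action.

Lemma tau_weak_representation (F : fieldType) (X : nil2comType F) :
  weak_representation (@tau F X).
Proof.
split=> [B B' f c|B]; last exact: tau_inj.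
by rewrite /spl_map tauE act_hom_pullback.
Qed.

Theorem theorem2p19 (F : fieldType) :
  [/\ (forall B X : nil2comType F,
         set_bij [set: SplExt B X] [set h : ahom B (br2 X) | dagger h]
                 (@tau F X B)),
      weakly_action_representable F /\
      (forall X : nil2comType F,
         (forall (B : nil2comType F) (E : split_ext B X),
            tau (to_class E) = act_hom E) /\
         weak_representation (@tau F X)) &
      (forall (X B : nil2comType F) (h : ahom B (br2 X)),
         acting_morphism (@tau F X) h <-> dagger h)].
Proof.
split=> [B X||X B h].
- split=> [c _|c c' _ _|h dh]; first exact: tau_dagger.
    exact: tau_inj.
  by have [c ch] := tau_surj dh; exists c.
- split=> X; last by split=> [B E|]; [exact: tauE | exact: tau_weak_representation].
  by exists (br2 X), (@tau F X); exact: tau_weak_representation.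
- by split=> [[c <-]|/tau_surj//]; exact: tau_dagger.
Qed.
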